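(* Let $G=(V,E)$ be a graph, let $u\notin V$, and let $G\vee u$ be the join of $G$ with the single vertex $u$. Let $c^*(G\vee u)$ denote the positive integer returned by the algorithm ACCN when $G$ is its primary instance (so that $G\vee u$ is its secondary instance). Then $\omega(G\vee u)\le c^*(G\vee u)$.
   Context: All graphs are finite (with non-empty vertex set), simple, undirected and loop-free. $\omega(H)$ is the clique number of $H$, i.e. the largest size of a set of pairwise adjacent vertices. For $u\notin V$, $G\vee u$ is the graph with vertex set $W=V\cup\{u\}$ whose edges are the edges of $G$ together with all $\{u,x\}$, $x\in V$. In $G\vee u$, $C(x)=N(x)\cup\{x\}$ is the closed neighbourhood of $x$. For $A\subset W$ and $z\in A$, $d_z(A)$ is the degree of $z$ in the subgraph of $G\vee u$ induced by $A$. Algorithm ACCN. Input: the vertex set and the adjacency matrix of the primary instance $G$. Phase 1: construct the vertex set and the adjacency matrix of the secondary instance $G\vee u$. Phase 2: for each $y\in W$: put $A=C(y)$; for each $z\in A$ compute $d_z(A)$; compute the largest $k$ such that there are at least $k$ vertices $z\in A$ with $d_z(A)\ge k$; set $c(y{:}u)=k+1$. Phase 3: for each $y\in W$ set $c^*(y{:}u)=c(y{:}u)$. Then, for each $y\in W$ with $y\ne u$: compute the largest $p$ such that there are at least $p$ vertices $z\in C(y)$, including $y$ and $u$ (i.e. $y$ and $u$ are among these vertices), such that $p\le c^*(z{:}u)$; set $c^*(y{:}u)=p$. Finally compute the largest $p$ such that there are at least $p$ vertices $z\in W$, including $u$, such that $p\le c^*(z{:}u)$; set $c^*(u{:}u)=p$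 and $c^*(G\vee u)=c^*(u{:}u)$. Return $c^*(G\vee u)$. *)

(* Defs.v *)
From mathcomp Require Import all_boot.
Set Implicit Arguments.
Unset Strict Implicit.
Unset Printing Implicit Defensive.

(* The edge relation is boolean, so it is also the adjacency matrix. *)
Record sgraph := SGraph {
  svertex :> finType;
  sedge : rel svertex;
  sedge_sym : symmetric sedge;
  sedge_irrefl : irreflexive sedge
}.

Definition clique (H : sgraph) (A : {set H}) : bool :=
  [forall x in A, forall y in A, (x != y) ==> sedge x y].

Definition clique_number (H : sgraph) : nat :=
  \max_(A : {set H} | clique A) #|A|.

(* The join of G with one new vertex: [None] is u, [Some x] is the vertex x
   of G. *)
Section Join.
Variable G : sgraph.

Definition join_edge : rel (option G) := fun a b =>
  match a, b with
  | Some x, Some y => sedge x y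
  | None, None => false
  | _, _ => true
  end.

Lemma join_edge_sym : symmetric join_edge.
Proof. by case=> [x|] [y|] //=; rewrite sedge_sym. Qed.

Lemma join_edge_irrefl : irreflexive join_edge.
Proof. by case=> [x|] //=; rewrite sedge_irrefl. Qed.

Definition join_vertex : sgraph := SGraph join_edge_sym join_edge_irrefl.

Definition apex : join_vertex := None.

End Join.

Arguments apex {G}.

Definition closed_nbhd (H : sgraph) (x : H) : {set H} :=
  [set z | (z == x) || sedge x z].

Definition deg_in (H : sgraph) (A : {set H}) (z : H) : nat :=
  #|[set x in A | sedge z x]|.

(* The largest k satisfying P, among k <= n; each use below takes for n an
   upper bound on all k satisfying P, and P 0 holds. *)
Definition largest (n : nat) (P : pred nat) : nat := \max_(k < n.+1 | P k) k.

Lemma largestP (n : nat) (P : pred nat) :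
  P 0 -> (forall k, P k -> k <= n) ->
  P (largest n P) /\ (forall k, P k -> k <= largest n P).
Proof.
move=> P0 Pn; split=> [|k Pk]; last first.
  have lt_kn : k < n.+1 by rewrite ltnS Pn.
  exact: (@leq_bigmax_cond _ (fun i : 'I_n.+1 => P i) val (Ordinal lt_kn)).
rewrite /largest; elim/big_ind: _ => // x y Px Py.
by rewrite /maxn; case: ifP.
Qed.

Section ACCN.
Variable G : sgraph.

Let W := join_vertex G.

Definition accn_c (y : W) : nat :=
  let A := closed_nbhd y in
  (largest #|A| (fun k => k <= #|[set z in A | k <= deg_in A z]|)).+1.

Definition accn_init : {ffun W -> nat} := [ffun y => accn_c y].

Definition accn_value (c : {ffun W -> nat}) (y : W) : nat :=
  largest #|closed_nbhd y|
    (fun p => let Z := [set z in closed_nbhd y | p <= c z] in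
              [&& y \in Z, apex \in Z & p <= #|Z|]).

(* The table is updated in place: later vertices see the new value at y. *)
Definition accn_step (c : {ffun W -> nat}) (y : W) : {ffun W -> nat} :=
  [ffun z => if z == y then accn_value c y else c z].

Definition accn_final (c : {ffun W -> nat}) : nat :=
  largest #|W|
    (fun p => let Z := [set z : W | p <= c z] in
              (apex \in Z) && (p <= #|Z|)).

(* [s] is the order in which the loop runs through the vertices y <> u; the
   algorithm leaves it open. *)
Definition accn (s : seq G) : nat :=
  accn_final (foldl accn_step accn_init [seq Some x | x <- s]).

End ACCN.

(* Main.v *)
Require Import Defs.
From mathcomp Require Import all_boot.

(** Fix a clique [K] of the join that contains the apex. The bound [#|K| <= c z]
    for every [z] in [K] is an invariant of the table [c] of the algorithm.

    It holds at the start: if [y] is in [K], then [K] lies inside the closed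
    neighbourhood of [y], and each vertex of [K] is adjacent there to the
    [#|K| - 1] others; so [#|K| - 1] is a candidate for the largest [k], and the
    stored value is one more than that ([accn_init_bounds_clique]). It is
    preserved by an update at [y], in whatever order the updates are made: [K]
    itself is then a set of [#|K|] vertices of the closed neighbourhood of [y],
    among them [y] and the apex, whose table values are at least [#|K|]
    ([accn_step_bounds_clique]). For the same reason the returned value is at
    least [#|K|] ([accn_final_bounds_clique]).

    Adjoining the apex to a clique yields a clique ([clique_add_apex]), so this
    bounds the size of every clique of the join. *)

Lemma leq_largest (n k : nat) (P : pred nat) :
  k <= n -> P k -> k <= largest n P.
Proof.
rewrite -ltnS => lt_kn Pk.
exact: (@leq_bigmax_cond _ (fun i : 'I_n.+1 => P i) val (Ordinal lt_kn)).
Qed.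

Lemma cliqueP {H : sgraph} {A : {set H}} :
  reflect {in A &, forall x y, x != y -> sedge x y} (clique A).
Proof.
apply: (iffP forall_inP) => [clA x y xA yA | clA x xA].
  by move/forall_inP: (clA x xA) => /(_ y yA)/implyP.
by apply/forall_inP=> y yA; apply/implyP; apply: clA.
Qed.

Lemma clique_sub_closed_nbhd {H : sgraph} {A : {set H}} {y : H} :
  clique A -> y \in A -> A \subset closed_nbhd y.
Proof.
move/cliqueP=> clA yA; apply/subsetP=> z zA; rewrite inE.
by case: (eqVneq z y) => //= z_neq_y; apply: clA; rewrite // eq_sym.
Qed.

Lemma clique_leq_deg_in {H : sgraph} {A B : {set H}} {z : H} :
  clique A -> A \subset B -> z \in A -> #|A|.-1 <= deg_in B z.
Proof.
move/cliqueP=> clA /subsetP sAB zA; rewrite (cardsD1 z A) zA /=.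
apply/subset_leq_card/subsetP=> x; rewrite !inE => /andP[x_neq_z xA].
by rewrite sAB //=; apply: clA; rewrite // eq_sym.
Qed.

Lemma clique_add_apex {G : sgraph} {A : {set join_vertex G}} :
  clique A -> clique (apex |: A).
Proof.
move/cliqueP=> clA; apply/cliqueP=> x y.
by case: x y => [x|] [y|] //; rewrite !inE /= => xA yA; apply: clA.
Qed.

Section CliqueInvariant.

Variables (G : sgraph) (K : {set join_vertex G}).
Hypotheses (K_clique : clique K) (apex_K : apex \in K).

Lemma accn_init_bounds_clique : {in K, forall z, #|K| <= accn_init G z}.
Proof.
move=> y yK; rewrite ffunE /accn_c.
have sKC := clique_sub_closed_nbhd K_clique yK.
have K_gt0 : 0 < #|K| by apply/card_gt0P; exists y.
rewrite -(prednK K_gt0) ltnS; apply: leq_largest.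
  exact: leq_trans (leq_pred _) (subset_leq_card sKC).
apply: leq_trans (leq_pred _) _.
apply/subset_leq_card/subsetP=> z zK.
rewrite inE (subsetP sKC) //=; exact: clique_leq_deg_in.
Qed.

Lemma accn_step_bounds_clique (c : {ffun join_vertex G -> nat}) y :
  {in K, forall z, #|K| <= c z} -> {in K, forall z, #|K| <= accn_step c y z}.
Proof.
move=> cK z zK; rewrite ffunE; case: eqP => [eq_zy | _]; last exact: cK.
rewrite -{y}eq_zy; have sKC := clique_sub_closed_nbhd K_clique zK.
have sKZ : K \subset [set x in closed_nbhd z | #|K| <= c x].
  by apply/subsetP=> x xK; rewrite inE (subsetP sKC) //= cK.
apply: leq_largest; first exact: subset_leq_card.
by apply/and3P; split; rewrite ?(subsetP sKZ) // subset_leq_card.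
Qed.

Lemma accn_loop_bounds_clique (c : {ffun join_vertex G -> nat}) ys :
  {in K, forall z, #|K| <= c z} ->
  {in K, forall z, #|K| <= foldl (@accn_step G) c ys z}.
Proof.
by elim: ys c => //= y ys IHys c cK; apply/IHys/accn_step_bounds_clique.
Qed.

Lemma accn_final_bounds_clique (c : {ffun join_vertex G -> nat}) :
  {in K, forall z, #|K| <= c z} -> #|K| <= accn_final c.
Proof.
move=> cK; apply: leq_largest; first exact: max_card.
have sKZ : K \subset [set z | #|K| <= c z].
  by apply/subsetP=> z zK; rewrite inE cK.
by apply/andP; split; rewrite ?(subsetP sKZ) // subset_leq_card.
Qed.

End CliqueInvariant.

Theorem proposition5p1 (G : sgraph) (G_nonempty : 0 < #|G|)
    (s : seq G) (s_order : perm_eq s (enum G)) :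
  clique_number (join_vertex G) <= accn s.
Proof.
apply/bigmax_leqP=> A /clique_add_apex clK.
have apexK : apex \in apex |: A by apply: setU11.
apply: leq_trans (subset_leq_card (subsetUr [set apex] A)) _.
apply/accn_final_bounds_clique/accn_loop_bounds_clique => //.
exact: accn_init_bounds_clique.
Qed.
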